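(* Let $n\in\mathbb{N}$, let $h\colon\mathbb{R}^n\to\mathbb{R}$ be a positively homogeneous function that is bounded on the unit sphere, let $E$ be a Dedekind complete vector lattice, and let $f_1,\dots,f_n\in E$. (i) If $h$ is upper semicontinuous with inf-sublinear representation $h(\bar{x})=\inf_{\phi\in\Phi}\phi(\bar{x})$ $(\bar{x}\in\mathbb{R}^n)$, where $\Phi$ is a family of sublinear maps $\mathbb{R}^n\to\mathbb{R}$, then $\inf_{\phi\in\Phi}\phi(f_1,\dots,f_n)$ exists in $E$. (ii) If $h$ is lower semicontinuous with sup-superlinear representation $h(\bar{x})=\sup_{\psi\in\Psi}\psi(\bar{x})$ $(\bar{x}\in\mathbb{R}^n)$, where $\Psi$ is a family of superlinear maps $\mathbb{R}^n\to\mathbb{R}$, then $\sup_{\psi\in\Psi}\psi(f_1,\dots,f_n)$ exists in $E$.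
   Context: A function $h\colon\mathbb{R}^n\to\mathbb{R}$ is positively homogeneous if $h(\lambda\bar{x})=\lambda h(\bar{x})$ for all $\lambda\in[0,\infty)$ and $\bar{x}\in\mathbb{R}^n$. It is bounded on the unit sphere if there are $m,M\in\mathbb{R}$ with $m\le h(\bar{x})\le M$ for all $\bar{x}$ with Euclidean norm $\|\bar{x}\|=1$. A map is sublinear if it is positively homogeneous and subadditive, and superlinear if its negative is sublinear. For $\phi\colon\mathbb{R}^n\to\mathbb{R}$ sublinear, $\underline{\partial}\phi(\bar{0}):=\{\bar{a}\in\mathbb{R}^n: \sum_{i=1}^n a_ix_i\le\phi(\bar{x})\text{ for all }\bar{x}\in\mathbb{R}^n\}$; for $\psi$ superlinear, $\overline{\partial}\psi(\bar{0}):=\{\bar{a}\in\mathbb{R}^n: \sum_{i=1}^n a_ix_i\ge\psi(\bar{x})\text{ for all }\bar{x}\in\mathbb{R}^n\}$. For $f_1,\dots,f_n$ in a Dedekind complete vector lattice $E$, $\phi(f_1,\dots,f_n):=\sup_{\bar{a}\in\underline{\partial}\phi(\bar{0})}\sum_{i=1}^n a_if_i$ and $\psi(f_1,\dots,f_n):=\inf_{\bar{a}\in\overline{\partial}\psi(\bar{0})}\sum_{i=1}^n a_if_i$; this supremum and this infimum always exist in $E$. *)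

(* Defs.v *)
From HB Require Import structures.
From mathcomp Require Import all_boot all_order all_algebra.
From mathcomp Require Import all_classical all_reals all_analysis.

Set Implicit Arguments.
Unset Strict Implicit.
Unset Printing Implicit Defensive.

Import Order.TTheory GRing.Theory Num.Theory.
Import numFieldNormedType.Exports.

Local Open Scope classical_set_scope.
Local Open Scope ring_scope.

(* Real vector lattices (Riesz spaces): ordered vector spaces in which any two
   elements have a supremum and an infimum.  [porderZmodType] by itself does
   not relate the order to the addition. *)
HB.mixin Record Lmodule_POrder_isVectorLattice (R : numDomainType) E
    of GRing.Lmodule R E & Num.POrderedZmodule E := {
  lev_add2r : forall z x y : E, x <= y -> x + z <= y + z;
  scalev_ge0 : forall (a : R) (x : E), 0 <= a -> 0 <= x -> 0 <= a *: x;
  vsup2_ex : forall x y : E, supremums [set x; y] !=set0;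
  vinf2_ex : forall x y : E, infimums [set x; y] !=set0
}.

#[short(type="vectorLatticeType")]
HB.structure Definition VectorLattice (R : numDomainType) :=
  {E of GRing.Lmodule R E & Num.POrderedZmodule E
      & Lmodule_POrder_isVectorLattice R E}.

Definition dedekind_complete (R : numDomainType) (E : vectorLatticeType R) :=
  forall A : set E, has_sup A -> supremums A !=set0.

Section FunctionsOnRn.
Context {R : realType} {n : nat}.
Implicit Types (h phi psi : 'rV[R]_n -> R) (x a : 'rV[R]_n).

(* The library norm on 'rV[R]_n is the max norm. *)
Definition euclidean_norm x : R := Num.sqrt (\sum_i x ord0 i ^+ 2).

Definition positively_homogeneous h :=
  forall (l : R) x, 0 <= l -> h (l *: x) = l * h x.

Definition bounded_on_unit_sphere h :=
  exists m M : R, forall x, euclidean_norm x = 1 -> m <= h x <= M.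

Definition sublinear phi :=
  positively_homogeneous phi /\ forall x y, phi (x + y) <= phi x + phi y.

Definition superlinear psi := sublinear (fun x => - psi x).

(* The subdifferential of a sublinear map at 0. *)
Definition subdiff0 phi : set 'rV[R]_n :=
  [set a | forall x, \sum_i a ord0 i * x ord0 i <= phi x].

(* The superdifferential of a superlinear map at 0. *)
Definition superdiff0 psi : set 'rV[R]_n :=
  [set a | forall x, \sum_i a ord0 i * x ord0 i >= psi x].

Context {E : vectorLatticeType R}.
Implicit Types f : 'I_n -> E.

(* phi(f_1, ..., f_n) for phi sublinear.  The default value 0 of [supremum] is
   not reached when E is Dedekind complete, since the supremum then exists. *)
Definition sublinear_calc phi f : E :=
  supremum 0 [set \sum_i a ord0 i *: f i | a in subdiff0 phi].

(* psi(f_1, ..., f_n) for psi superlinear; same remark for [infimum]. *)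
Definition superlinear_calc psi f : E :=
  infimum 0 [set \sum_i a ord0 i *: f i | a in superdiff0 psi].

End FunctionsOnRn.

(* Dual of the library's [lower_semicontinuous]. *)
Definition upper_semicontinuous {X : topologicalType} {R : numFieldType}
    (f : X -> \bar R) :=
  forall x a, (f x < a%:E)%E ->
    exists2 V, nbhs x V & forall y, V y -> (f y < a%:E)%E.

(* Main.v *)
Require Import Defs.
From mathcomp Require Import all_boot all_order all_algebra.
From mathcomp Require Import all_classical all_reals all_analysis.
From mathcomp Require Import ring lra.

Import Order.TTheory GRing.Theory Num.Theory.
Import numFieldNormedType.Exports.

Local Open Scope classical_set_scope.
Local Open Scope ring_scope.

(** In a Dedekind complete vector lattice the infimum in (i) exists as soon as
    the values phi(f_1, ..., f_n), for phi in Phi, have a common lower bound,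
    and Phi is not empty because no real number is an infimum of the empty set.

    A positively homogeneous function that is bounded on the unit sphere
    satisfies |h x| <= C * sum_i |x_i| for some C >= 0
    ([positively_homogeneous_bounded]).  As phi >= h for every phi in Phi, the
    same C gives phi >= - C * sum_i |x_i| for all of them.  The sandwich form
    of the Hahn-Banach theorem puts a linear form between the superlinear map
    - C * sum_i |x_i| and the sublinear map phi: a subgradient a of phi with
    |a_i| <= C for all i ([sublinear_bounded_subgradient]).  Since
    phi(f_1, ..., f_n) is a supremum over the subgradients of phi, it is at
    least sum_i a_i f_i ([sublinear_calc_ge]), hence at least - b, where b
    bounds every combination of the f_i with coefficients in [-C, C]
    ([bounded_combinations]).  This b does not depend on phi.

    Part (ii) is dual: - psi >= - C * sum_i |x_i|, and the opposite of a
    subgradient of - psi is a supergradient of psi.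

    The sandwich theorem is obtained by convolution: if g is sublinear on a
    convex cone K and p + g >= 0 on K, then
    q x = inf over y in K of p (x + y) + g y
    is a sublinear minorant of p with q (- y) <= g y on K
    ([inf_convolution]).  With K the whole space and g = C * sum_i |x_i| the
    minorants of q have coefficients bounded by C.  With K a ray spanned by v
    and g = - p, it makes p linear along v; doing so for each vector of the
    canonical basis leaves a linear form, which is a subgradient. *)

(** * Sublinear minorants and subgradients *)

Section Subgradients.
Context {R : realType} {n : nat}.
Implicit Types (p q phi psi : 'rV[R]_n -> R) (x y v a : 'rV[R]_n).

Lemma sublinear0 p : sublinear p -> p 0 = 0.
Proof. by case=> ph _; have := ph 0 0 (lexx 0); rewrite scale0r mul0r. Qed.

Lemma sublinear_ge_oppN p x : sublinear p -> - p (- x) <= p x.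
Proof.
move=> ps; have := ps.2 x (- x); rewrite subrr sublinear0//; lra.
Qed.

Lemma sublinear_sum p (I : Type) (r : seq I) (F : I -> 'rV[R]_n) :
  sublinear p -> p (\sum_(i <- r) F i) <= \sum_(i <- r) p (F i).
Proof.
move=> ps; elim: r => [|i r IH]; first by rewrite !big_nil sublinear0.
by rewrite !big_cons (le_trans (ps.2 _ _))// lerD2l.
Qed.

(** Both steps of the sandwich theorem are instances of this construction.  The
    hypothesis - g <= p on K keeps the infimum finite, because
    p y <= p (x + y) + p (- x). *)
Lemma inf_convolution p (K : set 'rV[R]_n) (g : 'rV[R]_n -> R) :
  sublinear p ->
  K 0 -> (forall x y, K x -> K y -> K (x + y)) ->
  (forall (l : R) x, 0 <= l -> K x -> K (l *: x)) ->
  (forall (l : R) x, 0 <= l -> K x -> g (l *: x) = l * g x) ->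
  (forall x y, K x -> K y -> g (x + y) <= g x + g y) ->
  (forall y, K y -> - g y <= p y) ->
  exists q, [/\ sublinear q, forall x, q x <= p x &
    forall y, K y -> q (- y) <= g y].
Proof.
move=> ps K0 KD KZ gZ gD gp.
pose S x := [set p (x + y) + g y | y in K].
have g0 : g 0 = 0 by have := gZ 0 0 (lexx _) K0; rewrite scale0r mul0r.
have Sn x : S x !=set0 by exists (p (x + 0) + g 0), 0.
have Sl x : has_lbound (S x).
  exists (- p (- x)) => _ [y Ky <-].
  have := ps.2 (x + y) (- x); rewrite addrC addKr.
  have := gp _ Ky; lra.
pose q x := inf (S x).
have q_le x y : K y -> q x <= p (x + y) + g y.
  by move=> Ky; apply: (ge_inf (Sl x)); exists y.
have qS x c : (forall y, K y -> c <= p (x + y) + g y) -> c <= q x.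
  by move=> H; apply: lb_le_inf => // _ [y Ky <-]; exact: H.
have qZ (l : R) x : 0 < l -> q (l *: x) <= l * q x.
  move=> l0; have l_ge0 := ltW l0; rewrite -ler_pdivrMl//; apply: qS => y Ky.
  rewrite ler_pdivrMl// mulrDr -ps.1// -gZ// scalerDr.
  by apply: q_le; exact: KZ.
exists q; split.
- split=> [l x|x y].
    rewrite le_eqVlt => /orP[/eqP <-|l0].
      rewrite scale0r mul0r; apply/eqP; rewrite eq_le; apply/andP; split.
        by have := q_le 0 0 K0; rewrite addr0 g0 (sublinear0 p)// addr0.
      by apply: qS => y Ky; rewrite add0r; have := gp _ Ky; lra.
    apply/eqP; rewrite eq_le qZ//= -ler_pdivlMl//.
    have := qZ l^-1 (l *: x); rewrite invr_gt0 => /(_ l0).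
    by rewrite scalerA mulVf ?gt_eqF// scale1r.
  rewrite -lerBlDr; apply: (qS) => u Ku; rewrite lerBlDr -lerBlDl.
  apply: qS => w Kw; rewrite lerBlDl.
  apply: (le_trans (q_le _ (u + w) (KD _ _ Ku Kw))).
  have := gD _ _ Ku Kw; have := ps.2 (x + u) (y + w).
  by rewrite addrACA; lra.
- by move=> x; have := q_le x 0 K0; rewrite addr0 g0 addr0.
- by move=> y Ky; have := q_le (- y) y Ky; rewrite addNr (sublinear0 p)// add0r.
Qed.

(** Convolution of p with - p along the ray of v: the resulting q satisfies
    q (- v) <= - p v <= - q v, and q v + q (- v) >= 0 always holds. *)
Lemma sublinear_minorant_linear_along p v : sublinear p ->
  exists q, [/\ sublinear q, forall x, q x <= p x & q (- v) = - q v].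
Proof.
move=> ps.
have [|_ _ [s s0 <-] [t t0 <-]|l _ l0 [t t0 <-]|l x l0 _|_ _ [s s0 <-] [t t0 <-]|y _|q [qs qp qv]] :=
  @inf_convolution p [set t *: v | t in [set t : R | 0 <= t]] (fun y => - p y) ps.
- by exists 0; rewrite /= ?scale0r.
- by exists (s + t); rewrite /= ?addr_ge0// scalerDl.
- by exists (l * t); rewrite /= ?mulr_ge0// scalerA.
- by rewrite ps.1// mulrN.
- by rewrite -scalerDl !ps.1 ?addr_ge0//; lra.
- by rewrite opprK.
exists q; split => //; apply/eqP; rewrite eq_le; apply/andP; split.
  by rewrite (le_trans (qv v _)) ?lerN2//; exists 1; rewrite /= ?scale1r.
by have := sublinear_ge_oppN _ v qs; lra.
Qed.

(** Oddness along a direction passes to sublinear minorants, so the directions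
    can be treated one after the other. *)
Lemma sublinear_minorant_linear_along_seq p (s : seq 'rV[R]_n) : sublinear p ->
  exists q, [/\ sublinear q, forall x, q x <= p x &
    {in s, forall v, q (- v) = - q v}].
Proof.
move=> ps; elim: s => [|v s [q [qs qp qv]]]; first by exists p.
have [r [rs rq rv]] := sublinear_minorant_linear_along q v qs.
exists r; split => // [x|w]; first exact: le_trans (rq x) (qp x).
rewrite in_cons => /orP[/eqP ->//|ws].
(* r <= q at both w and - w, where q is odd, while r w + r (- w) >= 0. *)
have := rq w; have := rq (- w); have := qv w ws.
have := sublinear_ge_oppN _ w rs; lra.
Qed.

Lemma dot_delta a i : \sum_j a ord0 j * delta_mx (0 : 'I_1) i 0 j = a ord0 i.
Proof.
rewrite (bigD1 i)//= big1 ?addr0 => [|j ji]; rewrite mxE !eqxx/=.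
  by rewrite mulr1.
by rewrite (negbTE ji) mulr0.
Qed.

(** The Hahn-Banach theorem in finite dimension.  A sublinear q that is odd on
    the canonical basis satisfies q y <= sum_i q (e_i) * y_i; at y = - x this
    also bounds q x from below, since - q (- x) <= q x. *)
Lemma subdiff0_nonempty p : sublinear p -> subdiff0 p !=set0.
Proof.
move=> ps; pose e (i : 'I_n) : 'rV[R]_n := delta_mx 0 i.
have [q [qs qp qe]] :=
  sublinear_minorant_linear_along_seq p [seq e i | i <- enum 'I_n] ps.
have qNe i : q (- e i) = - q (e i).
  by apply: qe; apply: map_f; rewrite mem_enum.
exists (\row_i q (e i)) => x.
have q_le y : q y <= \sum_i q (e i) * y ord0 i.
  rewrite {1}[y]row_sum_delta (le_trans (sublinear_sum _ _ _ _ qs))//.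
  apply: ler_sum => i _; have [y0|y0] := leP 0 (y ord0 i).
    by rewrite qs.1// mulrC.
  rewrite -[_ *: _]opprK -scalerN -scaleNr qs.1; last by rewrite oppr_ge0 ltW.
  by rewrite qNe mulrNN mulrC.
apply: le_trans (qp x); apply: le_trans (sublinear_ge_oppN _ _ qs).
rewrite lerNr (le_trans (q_le _))// -sumrN; apply: ler_sum => i _.
by rewrite !mxE; lra.
Qed.

Definition norm1 x : R := \sum_i `|x ord0 i|.

Lemma norm1_delta (i : 'I_n) : norm1 (delta_mx 0 i) = 1.
Proof.
rewrite /norm1 (bigD1 i)//= big1 ?addr0 => [|j ji]; rewrite mxE !eqxx/=.
  by rewrite normr1.
by rewrite (negbTE ji) normr0.
Qed.

Lemma norm1N x : norm1 (- x) = norm1 x.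
Proof. by apply: eq_bigr => i _; rewrite mxE normrN. Qed.

(** The convolution q of phi with C * norm1 lies below both phi and C * norm1;
    a linear form below q is thus a subgradient of phi, and comparing it with
    C * norm1 at the basis vectors and their opposites bounds its
    coefficients. *)
Lemma sublinear_bounded_subgradient phi (C : R) : 0 <= C -> sublinear phi ->
  (forall x, - (C * norm1 x) <= phi x) ->
  exists2 a, subdiff0 phi a & forall i, `|a ord0 i| <= C.
Proof.
move=> C0 phis phiC.
have [//|//|//|l x l0 _|x y _ _|//|q [qs qp qC]] :=
  @inf_convolution phi setT (fun x => C * norm1 x) phis.
- rewrite mulrCA; congr (_ * _); rewrite /norm1 mulr_sumr.
  by apply: eq_bigr => i _; rewrite mxE normrM ger0_norm.
- rewrite -mulrDr ler_wpM2l// /norm1 -big_split/=.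
  by apply: ler_sum => i _; rewrite mxE ler_normD.
have [a aq] := subdiff0_nonempty q qs.
exists a => [x|i]; first exact: le_trans (aq x) (qp x).
have qC' y : q y <= C * norm1 y by have := qC (- y) I; rewrite opprK norm1N.
rewrite ler_norml -[C]mulr1 -(norm1_delta i) -(dot_delta a i).
apply/andP; split; last first.
  exact: le_trans (aq _) (qC' _).
rewrite lerNl -norm1N; apply: le_trans (qC' _); apply: le_trans (aq _).
by rewrite -sumrN; apply: ler_sum => j _; rewrite !mxE mulrN.
Qed.

(** This is why the supremum defining phi(f_1, ..., f_n) exists: a subgradient
    is controlled by the values of phi at the vectors e_i and - e_i. *)
Lemma subdiff0_bounded phi :
  exists K : R, forall a, subdiff0 phi a -> forall i, `|a ord0 i| <= K.
Proof.
pose e (i : 'I_n) : 'rV[R]_n := delta_mx 0 i.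
exists (\sum_i (`|phi (e i)| + `|phi (- e i)|)).
move=> a aphi i; rewrite (bigD1 i)//=; have := aphi (e i); have := aphi (- e i).
have -> : \sum_j a ord0 j * (- e i) ord0 j = - a ord0 i.
  by rewrite -dot_delta -sumrN; apply: eq_bigr => j _; rewrite mxE mulrN.
rewrite dot_delta => aN aP.
have S0 : 0 <= \sum_(j | j != i) (`|phi (e j)| + `|phi (- e j)|).
  by apply: sumr_ge0 => j _; exact: addr_ge0.
rewrite ler_norml; have := ler_norm (phi (e i)); have := ler_norm (phi (- e i)).
have := normr_ge0 (phi (e i)); have := normr_ge0 (phi (- e i)).
by move=> *; apply/andP; split; lra.
Qed.

Lemma superdiff0_opp psi a :
  superdiff0 psi a <-> subdiff0 (fun x => - psi x) (- a).
Proof.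
have dotN x : \sum_i (- a) ord0 i * x ord0 i = - \sum_i a ord0 i * x ord0 i.
  by rewrite -sumrN; apply: eq_bigr => i _; rewrite mxE mulNr.
by split=> H x; have := H x; rewrite dotN lerN2.
Qed.

Lemma euclidean_norm_le_norm1 x : euclidean_norm x <= norm1 x.
Proof.
have N0 : 0 <= norm1 x by apply: sumr_ge0.
rewrite -[norm1 x]ger0_norm// -sqrtr_sqr ler_wsqrtr// expr2 {1}/norm1 mulr_suml.
apply: ler_sum => i _; rewrite -real_normK ?num_real// expr2 ler_wpM2l//.
by rewrite /norm1 (bigD1 i)//= lerDl sumr_ge0.
Qed.

(** The l1 norm is preferred to the Euclidean one because C * norm1 dominates a
    linear form exactly when the coefficients of the form are at most C in
    absolute value. *)
Lemma positively_homogeneous_bounded (h : 'rV[R]_n -> R) :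
  positively_homogeneous h -> bounded_on_unit_sphere h ->
  exists C : R, 0 <= C /\ forall x, `|h x| <= C * norm1 x.
Proof.
move=> hh [m [M hmM]]; exists (`|m| + `|M|); split; first exact: addr_ge0.
move=> x; have N0 : 0 <= norm1 x by apply: sumr_ge0.
have [x0|x0] := eqVneq x 0.
  have := hh 0 0 (lexx _); rewrite x0 scale0r mul0r => ->.
  by rewrite normr0 mulr_ge0 ?addr_ge0 // -x0.
have sq0 : 0 <= \sum_i x ord0 i ^+ 2 by apply: sumr_ge0 => i _; exact: sqr_ge0.
have r0 : 0 < euclidean_norm x.
  rewrite sqrtr_gt0 lt_def sq0 andbT; apply: contra_neq x0 => sum0.
  apply/rowP => i; rewrite mxE; apply/eqP; rewrite -sqrf_eq0; apply/eqP.
  exact: (psumr_eq0P (fun i _ => sqr_ge0 (x ord0 i)) sum0).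
set r := euclidean_norm x in r0.
have u1 : euclidean_norm (r^-1 *: x) = 1.
  rewrite /euclidean_norm.
  under eq_bigr do rewrite mxE exprMn.
  rewrite -mulr_sumr sqrtrM ?sqr_ge0// sqrtr_sqr gtr0_norm ?invr_gt0//.
  by rewrite mulVf ?gt_eqF.
rewrite -[x in h x](scalerKV (lt0r_neq0 r0)) hh; last exact: ltW.
rewrite normrM gtr0_norm// mulrC.
apply: ler_pM => //; [exact: ltW| |exact: euclidean_norm_le_norm1].
have /andP[h1 h2] := hmM _ u1.
have := ler_norm M; have := ler_norm (- m); rewrite normrN.
have := normr_ge0 M; have := normr_ge0 m.
by rewrite ler_norml => *; apply/andP; split; lra.
Qed.

End Subgradients.

(** * Order bounds in vector lattices *)

Section VectorLattice.
Context {R : realType} {E : vectorLatticeType R}.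
Implicit Types (x y z : E).

Lemma lev_add x y x' y' : x <= y -> x' <= y' -> x + x' <= y + y'.
Proof.
move=> xy xy'; apply: (le_trans (lev_add2r x' _ _ xy)).
by rewrite ![y + _]addrC; exact: lev_add2r.
Qed.

Lemma subv_ge0 x y : (0 <= y - x) = (x <= y).
Proof.
apply/idP/idP => [/(lev_add2r x _ _)|/(lev_add2r (- x) _ _)].
  by rewrite add0r subrK.
by rewrite subrr.
Qed.

Lemma lev_sum (I : Type) (r : seq I) (F G : I -> E) :
  (forall i, F i <= G i) -> \sum_(i <- r) F i <= \sum_(i <- r) G i.
Proof.
move=> FG; elim: r => [|i r IH]; first by rewrite !big_nil.
by rewrite !big_cons lev_add.
Qed.

(** C u - c x is the combination of u - x and u + x with the nonnegative
    coefficients (C + c) / 2 and (C - c) / 2. *)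
Lemma scalev_le_dominated (C c : R) x u : x <= u -> - x <= u -> `|c| <= C ->
  c *: x <= C *: u.
Proof.
rewrite ler_norml => xu Nxu /andP[c1 c2].
pose s := (C + c) / 2; pose t := (C - c) / 2.
have CE : C = s + t by rewrite /s /t; field.
have cE : c = s - t by rewrite /s /t; field.
have s0 : 0 <= s by rewrite /s; lra.
have t0 : 0 <= t by rewrite /t; lra.
rewrite -subv_ge0.
have -> : C *: u - c *: x = s *: (u - x) + t *: (u - (- x)).
  rewrite CE cE opprK scalerDl scalerBl !scalerDr scalerN opprB.
  by rewrite (addrC (t *: x)) addrACA.
have := lev_add 0 (s *: (u - x)) 0 (t *: (u - (- x))); rewrite addr0.
by apply; apply: scalev_ge0; rewrite ?subv_ge0.
Qed.

(** Any u_i above f_i and - f_i, such as the modulus of f_i, gives the bound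
    C * sum_i u_i. *)
Lemma bounded_combinations n (C : R) (f : 'I_n -> E) : exists b : E,
  forall a : 'rV[R]_n, (forall i, `|a ord0 i| <= C) ->
    - b <= \sum_i a ord0 i *: f i <= b.
Proof.
have dom i : exists u, f i <= u /\ - f i <= u.
  have [u [uub _]] := vsup2_ex (f i) (- f i).
  by exists u; split; apply: uub; [left|right].
have [u fu] := choice dom.
exists (\sum_i C *: u i) => a aC; apply/andP; split.
  rewrite -subv_ge0 opprK addrC -[X in _ + X]opprK subv_ge0 -sumrN.
  apply: lev_sum => i; rewrite -scaleNr.
  by apply: scalev_le_dominated; rewrite ?normrN //; case: (fu i).
by apply: lev_sum => i; apply: scalev_le_dominated => //; case: (fu i).
Qed.

Lemma dedekind_complete_infimums (A : set E) : dedekind_complete E ->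
  A !=set0 -> has_lbound A -> infimums A !=set0.
Proof.
move=> dc [x Ax] lA; have [|s [sub sl]] := dc (lbound A).
  by split=> //; exists x => y; apply.
by exists s; split => // y Ay; apply: sl => z; apply.
Qed.

Lemma supremumP (x0 : E) (A : set E) : dedekind_complete E -> has_sup A ->
  supremums A (supremum x0 A).
Proof.
move=> dc hA; rewrite /supremum; case: ifPn => [/eqP A0|_].
  by case: hA => -[x]; rewrite A0.
by apply: xgetPex; exact: dc.
Qed.

Lemma infimumP (x0 : E) (A : set E) : dedekind_complete E -> has_inf A ->
  infimums A (infimum x0 A).
Proof.
move=> dc [nA lA]; rewrite /infimum; case: ifPn => [/eqP A0|_].
  by case: nA => x; rewrite A0.
by apply: xgetPex; exact: dedekind_complete_infimums.
Qed.

Lemma sublinear_calc_ge n (phi : 'rV[R]_n -> R) (f : 'I_n -> E) a :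
  dedekind_complete E -> subdiff0 phi a ->
  \sum_i a ord0 i *: f i <= sublinear_calc phi f.
Proof.
move=> dc aphi; have [K phiK] := subdiff0_bounded phi.
have [b bb] := bounded_combinations n K f.
rewrite /sublinear_calc; set A := [set _ | _ in _].
have [|ub _] := supremumP 0 A dc; last by apply: ub; exists a.
split; first by exists (\sum_i a ord0 i *: f i), a.
by exists b => _ [c cphi <-]; have /andP[] := bb c (phiK c cphi).
Qed.

Lemma superlinear_calc_le n (psi : 'rV[R]_n -> R) (f : 'I_n -> E) a :
  dedekind_complete E -> superdiff0 psi a ->
  superlinear_calc psi f <= \sum_i a ord0 i *: f i.
Proof.
move=> dc apsi; have [K psiK] := subdiff0_bounded (fun v => - psi v).
have [b bb] := bounded_combinations n K f.
rewrite /superlinear_calc; set A := [set _ | _ in _].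
have [|lb _] := infimumP 0 A dc; last by apply: lb; exists a.
split; first by exists (\sum_i a ord0 i *: f i), a.
exists (- b) => _ [c /superdiff0_opp /psiK cK <-].
have /bb/andP[] // : forall i, `|c ord0 i| <= K.
by move=> i; have := cK i; rewrite mxE normrN.
Qed.

End VectorLattice.

(** * Existence of the infimum and of the supremum *)

Lemma infimums_nonempty {R : realType} (A : set R) (r : R) :
  infimums A r -> A !=set0.
Proof.
move=> [_ rub]; apply/set0P/eqP => A0.
have : r + 1 <= r by apply: rub => y; rewrite A0.
lra.
Qed.

Lemma supremums_nonempty {R : realType} (A : set R) (r : R) :
  supremums A r -> A !=set0.
Proof.
move=> [_ rlb]; apply/set0P/eqP => A0.
have : r <= r - 1 by apply: rlb => y; rewrite A0.
lra.
Qed.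

Theorem theorem5p8 (R : realType) (n : nat) (h : 'rV[R]_n -> R)
    (h_homo : positively_homogeneous h) (h_bounded : bounded_on_unit_sphere h)
    (E : vectorLatticeType R) (E_complete : dedekind_complete E)
    (f : 'I_n -> E) :
  (forall Phi : set ('rV[R]_n -> R),
     upper_semicontinuous (EFin \o h) ->
     (forall phi, Phi phi -> sublinear phi) ->
     (forall x, infimums [set phi x | phi in Phi] (h x)) ->
     exists g : E, infimums [set sublinear_calc phi f | phi in Phi] g) /\
  (forall Psi : set ('rV[R]_n -> R),
     lower_semicontinuous (EFin \o h) ->
     (forall psi, Psi psi -> superlinear psi) ->
     (forall x, supremums [set psi x | psi in Psi] (h x)) ->
     exists g : E, supremums [set superlinear_calc psi f | psi in Psi] g).
Proof.
have [C [C0 hC]] := positively_homogeneous_bounded h h_homo h_bounded.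
have [b bb] := bounded_combinations n C f.
split=> [Phi _ Phis Phih|Psi _ Psis Psih].
- apply: dedekind_complete_infimums => //.
    have [_ [phi Phiphi _]] := infimums_nonempty _ _ (Phih 0).
    by exists (sublinear_calc phi f), phi.
  exists (- b) => _ [phi Phiphi <-].
  have phiC x : - (C * norm1 x) <= phi x.
    have hphi : h x <= phi x by apply: (Phih x).1; exists phi.
    have := hC x; rewrite ler_norml => /andP[hCx _].
    exact: le_trans hCx hphi.
  have [a aphi aC] := sublinear_bounded_subgradient phi C C0 (Phis _ Phiphi) phiC.
  apply: le_trans (sublinear_calc_ge n phi f a E_complete aphi).
  by have /andP[] := bb a aC.
- apply: (E_complete); split.
    have [_ [psi Psipsi _]] := supremums_nonempty _ _ (Psih 0).
    by exists (superlinear_calc psi f), psi.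
  exists b => _ [psi Psipsi <-].
  have psiC x : - (C * norm1 x) <= - psi x.
    have psih : psi x <= h x by apply: (Psih x).1; exists psi.
    have := hC x; rewrite ler_norml lerN2 => /andP[_].
    exact: le_trans.
  have [a apsi aC] := sublinear_bounded_subgradient _ C C0 (Psis _ Psipsi) psiC.
  have Napsi : superdiff0 psi (- a) by apply/superdiff0_opp; rewrite opprK.
  apply: (le_trans (superlinear_calc_le n psi f (- a) E_complete Napsi)).
  have /bb/andP[] // : forall i, `|(- a) ord0 i| <= C.
  by move=> i; rewrite mxE normrN.
Qed.
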